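(* Let $(T,d)$ be a compact metric space, $\Sigma$ its Borel $\sigma$-algebra, $\mu:\Sigma\to[0,\infty)$ a regular, countably additive, pointwise non atomic measure, and $X$ a Banach space. If $F:T\to cwk(X)$ is H-integrable, then there exists an H-integrable function $f:T\to X$ such that $f(t)\in F(t)$ for $\mu$-almost every $t\in T$.
   Context: Pointwise non atomic means $\mu(\{t\})=0$ for every $t\in T$. $cwk(X)$ is the family of all non-empty convex weakly compact subsets of $X$; $d_H$ is the Hausdorff distance. A gauge is any map $\gamma:T\to(0,\infty)$. A partition of $T$ is a finite family $\Pi=\{(E_i,t_i):i=1,\dots,k\}$ with $t_i\in T$, $E_i\in\Sigma$, $\mu(E_i\cap E_j)=0$ for $i\ne j$, and $\bigcup_i E_i=T$ (the tags $t_i$ need not lie in $E_i$). It is $\gamma$-fine if $d(w,t_i)<\gamma(t_i)$ for every $w\in E_i$ and every $i$. A function $f:T\to X$ is H-integrable if there is $I\in X$ such that for every $\varepsilon>0$ there is a gauge $\gamma$ with $\|\sum_{i} f(t_i)\mu(E_i)-I\|\le\varepsilon$ for every $\gamma$-fine partition $\{(E_i,t_i)\}$ of $T$. (Since $\mu$ is pointwise non atomic, requiring in addition $t_i\in E_i$ gives an equivalent notion.) A multifunction $F:T\to cwk(X)$ is H-integrable if there is $J\in cwk(X)$ such that for every $\varepsilon>0$ there is a gauge $\gamma$ with $d_H(\sum_{\Pi}F,J)\le\varepsilon$ for every $\gamma$-fine partition $\Pi=\{(E_i,t_i)\}$ of $T$, where $\sum_\Pi F=\sum_i \mu(E_i)F(t_i)$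 (Minkowski sum). *)

(* Defs.v *)
From HB Require Import structures.
From mathcomp Require Import all_boot all_order all_algebra.
From mathcomp Require Import all_classical all_reals all_analysis.

Set Implicit Arguments.
Unset Strict Implicit.
Unset Printing Implicit Defensive.

Import Order.TTheory GRing.Theory Num.Theory.
Import numFieldNormedType.Exports.

Local Open Scope classical_set_scope.
Local Open Scope ring_scope.

(* [measurableType] inherits from [pointedType], so a metric space has to be
   pointed (i.e. nonempty) in order to carry its Borel sigma-algebra. *)
#[short(type="pointedMetricType")]
HB.structure Definition PointedMetric (K : numDomainType) :=
  {M of Metric K M & Pointed M}.

Definition borel_type (T : ptopologicalType) := g_sigma_algebraType (@open T).

Definition regular_measure (R : realType) (T : ptopologicalType)
    (mu : {measure set (borel_type T) -> \bar R}) : Prop :=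
  forall A : set (borel_type T), measurable A ->
    mu A = ereal_inf [set mu U | U in [set U : set T | open U /\ A `<=` U]] /\
    mu A = ereal_sup [set mu C | C in [set C : set T | compact C /\ C `<=` A]].

Definition pointwise_nonatomic (R : realType) (T : ptopologicalType)
    (mu : {measure set (borel_type T) -> \bar R}) : Prop :=
  forall t : T, mu [set t] = 0%E.

(* X with its weak topology: the coarsest topology for which all the continuous
   linear functionals are continuous *)
Definition weak_type (R : realType) (X : normedModType R) : Type :=
  @sup_topology X {phi : {linear X -> R^o} | continuous phi}
    (fun phi => Topological.class (initial_topology (projT1 phi))).

Definition weakly_compact (R : realType) (X : normedModType R) (A : set X) :=
  compact (A : set (weak_type X)).

Definition cwk (R : realType) (X : normedModType R) (A : set X) : Prop :=
  [/\ A !=set0, convex_set A & weakly_compact A].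

(* The values are extended reals: the excess of A over B is +oo when A is
   unbounded and B is bounded. *)
Definition excess (R : realType) (X : normedModType R) (A B : set X) : \bar R :=
  ereal_sup [set ereal_inf [set `|a - b|%:E | b in B] | a in A].

Definition hausdorff_dist (R : realType) (X : normedModType R) (A B : set X) :
    \bar R :=
  Order.max (excess A B) (excess B A).

Definition minkowski_sum (R : realType) (X : normedModType R) (k : nat)
    (A : 'I_k -> set X) : set X :=
  [set \sum_(i < k) x i | x in [set x : 'I_k -> X | forall i, A i (x i)]].

(* A finite family (E_i, t_i) is given by the two maps E and t; the tags t_i
   are not required to lie in E_i, so they only enter [gauge_fine]. *)
Definition is_partition (R : realType) (T : ptopologicalType)
    (mu : {measure set (borel_type T) -> \bar R}) (k : nat)
    (E : 'I_k -> set (borel_type T)) : Prop :=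
  [/\ forall i, measurable (E i),
      forall i j, i != j -> mu (E i `&` E j) = 0%E
    & \bigcup_i E i = [set: T]].

Definition gauge_fine (R : realType) (T : metricType R)
    (gamma : T -> {posnum R}) (k : nat) (E : 'I_k -> set T) (t : 'I_k -> T) :
    Prop :=
  forall i w, E i w -> mdist w (t i) < (gamma (t i))%:num.

Definition H_integrable (R : realType) (T : pointedMetricType R)
    (X : normedModType R) (mu : {measure set (borel_type T) -> \bar R})
    (f : T -> X) : Prop :=
  exists I : X, forall eps : R, 0 < eps ->
    exists gamma : T -> {posnum R},
      forall (k : nat) (E : 'I_k -> set (borel_type T)) (t : 'I_k -> T),
        is_partition mu E -> gauge_fine gamma E t ->
        `|\sum_(i < k) fine (mu (E i)) *: f (t i) - I| <= eps.

Definition H_integrable_multi (R : realType) (T : pointedMetricType R)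
    (X : normedModType R) (mu : {measure set (borel_type T) -> \bar R})
    (F : T -> set X) : Prop :=
  exists2 J : set X, cwk J & forall eps : R, 0 < eps ->
    exists gamma : T -> {posnum R},
      forall (k : nat) (E : 'I_k -> set (borel_type T)) (t : 'I_k -> T),
        is_partition mu E -> gauge_fine gamma E t ->
        (hausdorff_dist
           (minkowski_sum
              (fun i => [set fine (mu (E i)) *: x | x in F (t i)]))
           J <= eps%:E)%E.

(* Main.v *)
(* A weakly compact convex set [J] has a strongly exposed point (Lindenstrauss,
   Troyanskii): some continuous linear form [g] attains its maximum over [J] at
   a point [x0] in such a way that the points of [J] where [g] is nearly maximal
   are close to [x0] in norm. Take for [J] the integral of [F] and choose [f t]
   in [F t] maximising [g] (the choice of Cascales, Kadets and Rodriguez). A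
   Riemann sum of [f] maximises [g] over the corresponding Riemann sum of [F],
   which is Hausdorff-close to [J]; so it is close to a point of [J] where [g]
   is nearly maximal, hence to [x0], and the integral of [f] is [x0].

   For the strongly exposed point, weakly compact sets are first shown to have
   relatively weakly open pieces of small diameter. The forms with a slice of
   small diameter are then dense in the dual, and a Baire argument there gives a
   form all of whose thin slices are small. *)

Require Import Defs.
From HB Require Import structures.
From mathcomp Require Import all_boot all_order all_algebra.
From mathcomp Require Import all_classical all_reals all_analysis.
From mathcomp Require Import finmap ring lra.

Set Implicit Arguments.
Unset Strict Implicit.
Unset Printing Implicit Defensive.

Import Order.TTheory GRing.Theory Num.Theory.
Import numFieldNormedType.Exports.

Local Open Scope classical_set_scope.
Local Open Scope ring_scope.

(** * The Hahn-Banach theorem *)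

Section sublinear.
Context {R : realType} {X : lmodType R}.
Implicit Types (p q : X -> R) (x y z : X).

Definition sublinear p :=
  (forall x y, p (x + y) <= p x + p y) /\
  (forall t x, 0 < t -> p (t *: x) <= t * p x).

Lemma sublinear0 p : sublinear p -> p 0 = 0.
Proof.
move=> [pD pZ]; have h1 := pD 0 0; rewrite addr0 in h1.
have h2 := pZ 2^-1 0 ltac:(by rewrite invr_gt0); rewrite scaler0 in h2.
lra.
Qed.

Lemma sublinearN p x : sublinear p -> - p (- x) <= p x.
Proof.
by move=> sp; have := sp.1 x (- x); rewrite subrr sublinear0// => ?; lra.
Qed.

Lemma sublinearZ p t x : sublinear p -> 0 <= t -> p (t *: x) = t * p x.
Proof.
move=> sp; rewrite le_eqVlt => /predU1P[<-|t0].
  by rewrite scale0r mul0r sublinear0.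
apply/eqP; rewrite eq_le sp.2//=.
have := sp.2 t^-1 (t *: x); rewrite scalerA mulVf ?gt_eqF// scale1r invr_gt0.
by move=> /(_ t0); rewrite mulrC ler_pdivlMr// mulrC.
Qed.

(** Serves three infima: along a ray, over a chain and over a subspace. The minorant [L] keeps them
    finite. *)
Lemma inf_sublinear (A : X -> set R) (L : X -> R) :
  (forall x, A x !=set0) -> (forall x a, A x a -> L x <= a) ->
  (forall x y a b, A x a -> A y b -> exists2 c, A (x + y) c & c <= a + b) ->
  (forall t x a, 0 < t -> A x a -> exists2 c, A (t *: x) c & c <= t * a) ->
  sublinear (fun x => inf (A x)).
Proof.
move=> A0 AL AD AZ.
have Ainf x a : A x a -> inf (A x) <= a.
  by move=> Aa; apply: ge_inf => //; exists (L x) => b /AL.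
have infle x c : (forall a, A x a -> c <= a) -> c <= inf (A x).
  by move=> h; apply: lb_le_inf => // a /h.
split=> [x y|t x t0].
  rewrite -lerBlDr; apply: (@infle _ _) => a Aa; rewrite lerBlDl -lerBlDr.
  apply: (@infle _ _) => b Ab; rewrite lerBlDl.
  by have [c /Ainf h hc] := AD _ _ _ _ Aa Ab; exact: le_trans h hc.
rewrite mulrC -ler_pdivrMr//; apply: (@infle _ _) => a Aa.
rewrite ler_pdivrMr// mulrC.
by have [c /Ainf h hc] := AZ _ _ _ t0 Aa; exact: le_trans h hc.
Qed.

(** Modifies a sublinear [p] to force additivity along [y]: [t = 0] keeps it below [p], and [t = 1]
    bounds its value at [- y] by [- p y]. *)
Definition shift_inf p y x :=
  inf [set a | exists2 t, 0 <= t & a = p (x + t *: y) - t * p y].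

Lemma shift_inf_sub p y : sublinear p ->
  sublinear (shift_inf p y) /\
  (forall t x, 0 <= t -> shift_inf p y x <= p (x + t *: y) - t * p y).
Proof.
move=> sp.
have lb x a : [set a | exists2 t, 0 <= t & a = p (x + t *: y) - t * p y] a ->
    - p (- x) <= a.
  move=> [t t0 ->]; have := sublinearZ y sp t0; have := sp.1 (x + t *: y) (- x).
  by rewrite addrAC subrr add0r => ? ?; lra.
split; last first.
  by move=> t x t0; apply: ge_inf; [exists (- p (- x)) => a /lb|exists t].
apply: (inf_sublinear (L := fun x => - p (- x))) => //.
- by move=> x; eexists; exists 0.
- move=> x z _ _ [s s0 ->] [t t0 ->].
  eexists; first by exists (s + t); [rewrite addr_ge0|reflexivity].
  have := sp.1 (x + s *: y) (z + t *: y).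
  by rewrite addrACA -scalerDl => ?; lra.
- move=> t x _ t0 [s s0 ->].
  eexists; first by exists (t * s); [rewrite mulr_ge0// ltW|reflexivity].
  have := sp.2 t (x + s *: y) t0.
  by rewrite scalerDr scalerA => ?; lra.
Qed.

(** Lower bounds of chains for Zorn's lemma. Subadditivity survives because the smaller of two
    members can serve both arguments. *)
Lemma chain_inf_sublinear p (C : set (X -> R)) : C !=set0 ->
  (forall q, C q -> sublinear q /\ forall x, q x <= p x) ->
  (forall q q', C q -> C q' ->
    (forall x, q x <= q' x) \/ (forall x, q' x <= q x)) ->
  sublinear (fun x => inf [set q x | q in C]) /\
  (forall q x, C q -> inf [set q x | q in C] <= q x).
Proof.
move=> [q0 Cq0] Cp tot.
have lb x a : [set q x | q in C] a -> - p (- x) <= a.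
  move=> [q /Cp[sq qp] <-]; apply: le_trans (sublinearN x sq).
  by rewrite lerN2.
split; last first.
  by move=> q x Cq; apply: ge_inf; [exists (- p (- x)) => a /lb|exists q].
apply: (inf_sublinear (L := fun x => - p (- x))) => //.
- by move=> x; exists (q0 x), q0.
- move=> x z _ _ [q Cq <-] [r Cr <-].
  have [h|h] := tot _ _ Cq Cr.
    exists (q (x + z)); first by exists q.
    by apply: (le_trans ((Cp _ Cq).1.1 _ _)); rewrite lerD2l.
  exists (r (x + z)); first by exists r.
  by apply: (le_trans ((Cp _ Cr).1.1 _ _)); rewrite lerD2r.
- move=> t x _ t0 [q Cq <-]; exists (q (t *: x)); first by exists q.
  exact: (Cp _ Cq).1.2.
Qed.

(* A sublinear functional that is minimal below [p] is linear, because
   [shift_inf q y] lies below [q]. *)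
Lemma sublinear_dominates_linear p : sublinear p ->
  exists2 g : X -> R, (forall a x y, g (a *: x + y) = a * g x + g y)
    & forall x, g x <= p x.
Proof.
move=> sp; pose S := {q : X -> R | sublinear q /\ forall x, q x <= p x}.
have mkS q : sublinear q -> (forall x, q x <= p x) -> {r : S | sval r = q}.
  by move=> h1 h2; exists (exist _ q (conj h1 h2)).
(* The order is reversed: a maximal element is a minimal functional. *)
pose le (q r : S) := `[< forall x, sval r x <= sval q x >].
have [p0 _] := mkS p sp (fun x => lexx _).
have [] := @ZL_preorder S p0 le.
- by move=> t; apply/asboolP.
- move=> r s t /asboolP rs /asboolP st; apply/asboolP => x.
  exact: le_trans (rs x).
- move=> A totA; have [[q0 Aq0]|A0] := pselect (A !=set0); last first.
    by exists p0 => s As; exfalso; apply: A0; exists s.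
  pose C := [set sval q | q in A].
  have [] := @chain_inf_sublinear p C.
  + by exists (sval q0), q0.
  + by move=> _ [q _ <-]; exact: (svalP q).
  + move=> _ _ [q Aq <-] [r Ar <-].
    by have [/asboolP|/asboolP] := totA _ _ Aq Ar; [right|left].
  move=> sI leI.
  have Ip x : inf [set q x | q in C] <= p x.
    apply: le_trans ((svalP q0).2 x); apply: (leI); by exists q0.
  have [r rE] := mkS _ sI Ip; exists r => s As; apply/asboolP => x.
  by rewrite rE; apply: (leI); exists s.
move=> [q [sq qp]] qmin; exists q => //.
have qD x y : q (x + y) = q x + q y.
  apply/eqP; rewrite eq_le sq.1/=.
  have [ss leS] := shift_inf_sub y sq.
  have leq z : shift_inf q y z <= q z.
    by have := leS 0 z (lexx 0); rewrite scale0r addr0 mul0r subr0.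
  have lep z : shift_inf q y z <= p z by exact: le_trans (qp z).
  have [r rE] := mkS _ ss lep.
  (* Minimality gives [q x <= shift_inf q y x], which by [t = 1] is at most [q (x + y) - q y]. *)
  have /asboolP/(_ x) : le r (exist _ q (conj sq qp)).
    by apply: qmin; apply/asboolP => z; rewrite rE.
  rewrite rE /= => h.
  by have := leS 1 x ler01; rewrite scale1r mul1r => ?; lra.
have qN x : q (- x) = - q x.
  have := qD x (- x); rewrite subrr sublinear0// => ?; lra.
move=> a x y; rewrite qD; congr (_ + _).
have [a0|a0] := leP 0 a; first exact: sublinearZ.
by rewrite -[a]opprK scaleNr qN sublinearZ// ?mulNr// oppr_ge0 ltW.
Qed.

(** A linear form below [shift_inf p x0] is below [p] and at most [- p x0] at [- x0], which forces
    equality at [x0]. *)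
Lemma hahn_banach p x0 : sublinear p ->
  exists g : X -> R, [/\ forall a x y, g (a *: x + y) = a * g x + g y,
    forall x, g x <= p x & g x0 = p x0].
Proof.
move=> sp; have [ss leS] := shift_inf_sub x0 sp.
have [g glin gle] := sublinear_dominates_linear ss.
have gp x : g x <= p x.
  apply: (le_trans (gle x)); have := leS 0 x (lexx 0).
  by rewrite scale0r addr0 mul0r subr0.
exists g; split => //; apply/eqP; rewrite eq_le gp/=.
have := leS 1 (- x0) ler01; rewrite scale1r addNr mul1r sublinear0// => h.
have := le_trans (gle _) h; have := glin (-1) x0 0.
have := glin 1 0 0; rewrite scaleN1r scaler0 !addr0 => ? ? ?.
lra.
Qed.

End sublinear.

(** * Continuous linear forms and the weak topology *)

Section weak.
Context {R : realType} {X : normedModType R}.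
Local Notation weak := (weak_type X).
Implicit Types (f g h : X -> R) (x y z u : X) (c C : R).

Definition linear_form g := forall a x y, g (a *: x + y) = a * g x + g y.

Definition dual_form g :=
  linear_form g /\ exists C, forall x, `|g x| <= C * `|x|.

Lemma linear_form0 g : linear_form g -> g 0 = 0.
Proof. by move=> /(_ 1 0 0); rewrite scaler0 addr0 => ?; lra. Qed.

Lemma linear_formZ g a x : linear_form g -> g (a *: x) = a * g x.
Proof. by move=> lg; rewrite -[a *: x]addr0 lg linear_form0// addr0. Qed.

Lemma linear_formD g x y : linear_form g -> g (x + y) = g x + g y.
Proof. by move=> lg; rewrite -{1}[x]scale1r lg mul1r. Qed.

Lemma linear_formN g x : linear_form g -> g (- x) = - g x.
Proof. by move=> lg; rewrite -scaleN1r linear_formZ// mulN1r. Qed.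

Lemma linear_formB g x y : linear_form g -> g (x - y) = g x - g y.
Proof. by move=> lg; rewrite linear_formD// linear_formN. Qed.

Lemma dual_form_dominated g C :
  linear_form g -> (forall x, g x <= C * `|x|) -> forall x, `|g x| <= C * `|x|.
Proof.
move=> lg gC x; rewrite ler_norml gC andbT.
by have := gC (- x); rewrite linear_formN// normrN => ?; lra.
Qed.

Lemma dual_formD f h c : dual_form f -> dual_form h ->
  dual_form (fun x => f x + c * h x).
Proof.
move=> [lf [C fC]] [lh [D hD]]; split=> [a x y|]; first by rewrite lf lh; ring.
exists (C + `|c| * D) => x; apply: (le_trans (ler_normD _ _)).
rewrite mulrDl; apply: lerD => //; rewrite normrM -mulrA.
by apply: ler_wpM2l.
Qed.

Lemma norming_form x : exists2 h, linear_form h &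
  (forall z, `|h z| <= `|z|) /\ h x = `|x|.
Proof.
have sn : sublinear (fun x => `|x|).
  split=> [y z|t y t0]; first exact: ler_normD.
  by rewrite normrZ gtr0_norm.
have [h [lh hn hx]] := hahn_banach x sn; exists h => //; split=> // z.
by have := dual_form_dominated lh (C := 1) _ z; rewrite mul1r; apply => y;
  rewrite mul1r.
Qed.

Lemma dual_form_weak_open g (A : set R) : dual_form g -> open A ->
  open (g @^-1` A : set weak).
Proof.
move=> [lg [C gC]] oA.
pose G := @GRing.isLinear.Build R X R^o *%R g lg.
pose phi : {linear X -> R^o} := HB.pack g G.
have cphi : continuous phi.
  apply/linear_bounded_continuous/linear_boundedP.
  exists C; split; first exact: num_real.
  move=> r Cr x; apply: (le_trans (gC x)).
  by apply: ler_wpM2r => //; exact: ltW.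
rewrite openE => x gAx.
have /cvg_sup/(_ (exist _ phi cphi)) : nbhs (x : weak) --> (x : weak) by [].
apply; rewrite nbhsE /=; exists (g @^-1` A) => //; split=> //; by exists A.
Qed.

Lemma dual_form_weak_continuous g : dual_form g -> continuous (g : weak -> R).
Proof. by move=> dg; apply/continuousP => A; exact: dual_form_weak_open. Qed.

Lemma weakly_compact_max (A : set X) g : dual_form g -> A !=set0 ->
  weakly_compact A -> exists2 x, A x & forall y, A y -> g y <= g x.
Proof.
move=> dg A0 cA.
have [|x xA xmax] := @compact_EVT_max weak R g A A0 cA.
  exact/continuous_subspaceT/dual_form_weak_continuous.
by exists x; [exact: set_mem|move=> y /mem_set/xmax].
Qed.

Lemma weak_closure_ge (A : set X) g a z : dual_form g ->
  (forall x, A x -> a <= g x) -> closure (A : set weak) z -> a <= g z.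
Proof.
move=> dg Aa cz; rewrite leNgt; apply/negP => gza.
have [|x [/Aa + /=]] := cz (g @^-1` [set r | r < a]).
  apply: open_nbhs_nbhs; split => //.
  by apply: (dual_form_weak_open dg); exact: open_lt.
by rewrite leNgt => /negP.
Qed.

(** Finite intersections of open half-spaces: weakly open sets that come with an induction, used in
    [polyhedron_absorbs]. *)
Inductive polyhedron : set X -> Prop :=
| polyhedronT : polyhedron setT
| polyhedronI W g a : polyhedron W -> dual_form g ->
    polyhedron (W `&` [set x | a < g x]).

Lemma polyhedron_weak_open W : polyhedron W -> open (W : set weak).
Proof.
elim=> [|{}W g a _ oW dg]; first exact: openT.
by apply: openI => //; exact: (dual_form_weak_open dg (@open_gt R a)).
Qed.

(* The boxes [box N s] are norm compact, and those on a growing sequence of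
   points [s] exhaust the linear span of the points. *)
Fixpoint box (N : R) (s : seq X) : set X :=
  if s is x :: s' then
    [set p.1 + p.2 *: x | p in box N s' `*` [set l : R | `|l| <= N]]
  else [set 0].

Lemma box_compact N s : compact (box N s).
Proof.
elim: s => [|x s ih] /=; first exact: compact_set1.
apply: continuous_compact.
  apply: continuous_subspaceT => p; apply: cvgD; first exact: cvg_fst.
  by apply: cvgZr_tmp; exact: cvg_snd.
apply: compact_setX => //.
have -> : [set l : R | `|l| <= N] = `[- N, N]%classic.
  by apply/seteqP; split => l /=; rewrite in_itv /= ler_norml.
exact: segment_compact.
Qed.

Lemma box0 N s : 0 <= N -> box N s 0.
Proof.
move=> N0; elim: s => //= x s ih.
by exists (0, 0) => /=; [rewrite normr0|rewrite scale0r addr0].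
Qed.

Lemma boxD N M s x y : box N s x -> box M s y -> box (N + M) s (x + y).
Proof.
elim: s x y => [|z s ih] x y /=; first by move=> -> ->; rewrite addr0.
move=> [[b l] /= [bb ll] <-] [[c k] /= [cb kk] <-].
exists (b + c, l + k) => /=; last by rewrite scalerDl addrACA.
split; first exact: ih.
by rewrite (le_trans (ler_normD _ _))// lerD.
Qed.

Lemma boxZ N s a x : box N s x -> box (`|a| * N) s (a *: x).
Proof.
elim: s x => [|z s ih] x /=; first by move=> ->; rewrite scaler0.
move=> [[b l] /= [bb ll] <-]; exists (a *: b, a * l) => /=.
  by split; [exact: ih|rewrite normrM ler_wpM2l].
by rewrite scalerDr scalerA.
Qed.

Lemma box_widen N M s : N <= M -> box N s `<=` box M s.
Proof.
move=> NM; elim: s => //= x s ih _ [[b l] /= [bb ll] <-].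
by exists (b, l) => //=; split; [exact: ih|exact: le_trans NM].
Qed.

Lemma box_cat N s t : 0 <= N -> box N s `<=` box N (t ++ s).
Proof.
move=> N0; elim: t => //= x t ih b /ih bb.
by exists (b, 0) => /=; [rewrite normr0|rewrite scale0r addr0].
Qed.

Lemma box_head N x s : 1 <= N -> box N (x :: s) x.
Proof.
move=> N1 /=; exists (0, 1) => /=; last by rewrite scale1r add0r.
by split; [apply: box0; exact: le_trans N1|rewrite normr1].
Qed.

End weak.

(** * Relatively weakly open sets of small diameter *)

Section fragmentation.
Context {R : realType} {X : normedModType R}.
Local Notation weak := (weak_type X).
Implicit Types (x y z q : X) (W D B : set X).

(** Hahn-Banach for the distance to [M], which is sublinear, below the norm, zero on [M] and at
    least [e] at [z]. *)
Lemma dist_subspace_form (M : set X) z (e : R) : M 0 ->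
  (forall x y, M x -> M y -> M (x + y)) ->
  (forall (a : R) x, M x -> M (a *: x)) -> 0 < e -> (forall m, M m -> e <= `|z - m|) ->
  exists g : X -> R, [/\ dual_form g, forall m, M m -> g m = 0 & e <= g z].
Proof.
move=> M0 MD MZ e0 ze; pose p x := inf [set `|x - m| | m in M].
have sp : sublinear p.
  apply: (inf_sublinear (L := fun=> 0)).
  - by move=> x; exists `|x - 0|, 0.
  - by move=> x _ [m _ <-].
  - move=> x y _ _ [m Mm <-] [n Mn <-]; exists `|(x + y) - (m + n)|.
      by exists (m + n) => //; exact: MD.
    by rewrite opprD addrACA ler_normD.
  - move=> t x _ t0 [m Mm <-]; exists `|t *: x - t *: m|.
      by exists (t *: m) => //; exact: MZ.
    by rewrite -scalerBr normrZ gtr0_norm.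
have ple x m : M m -> p x <= `|x - m|.
  by move=> Mm; apply: ge_inf; [exists 0 => _ [n _ <-]|exists m].
have [g [lg gp gz]] := hahn_banach z sp.
exists g; split.
- split=> //; exists 1; apply: dual_form_dominated => // x.
  by rewrite mul1r (le_trans (gp x))// (le_trans (ple _ _ M0))// subr0.
- move=> m Mm; apply/eqP; rewrite eq_le.
  have gle0 n : M n -> g n <= 0.
    by move=> Mn; rewrite (le_trans (gp n))// (le_trans (ple _ _ Mn))// subrr normr0.
  rewrite gle0//= -oppr_le0 -linear_formN// gle0// -scaleN1r; exact: MZ.
- rewrite gz; apply: lb_le_inf; first by exists `|z - 0|, 0.
  by move=> _ [m Mm <-]; exact: ze.
Qed.

Section rough.
Variables (D : set X) (eps : R).
Hypotheses (eps0 : 0 < eps) (rough : forall W, polyhedron W -> W `&` D !=set0 ->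
  exists x y, [/\ (W `&` D) x, (W `&` D) y & eps < `|x - y|]).

(** Of two points more than [eps] apart, one is farther than [eps / 2] from [q]. A half-space given
    by its norming form keeps that distance on weak closures. *)
Lemma rough_avoid_point W q : polyhedron W -> W `&` D !=set0 ->
  exists V, [/\ polyhedron V, V `<=` W, V `&` D !=set0 &
    forall z, closure (V : set weak) z -> eps / 2 <= `|z - q|].
Proof.
move=> pW WD; have [x [xWD xq]] : exists x, (W `&` D) x /\ eps / 2 < `|x - q|.
  have [x [y [xWD yWD xy]]] := rough pW WD.
  have [h|h] := ltP (eps / 2) `|x - q|; first by exists x.
  exists y; split => //; have := ler_distD q x y; rewrite (distrC q y) => ?; lra.
have [h lh [hn hx]] := norming_form (x - q).
have dh : dual_form h by split=> //; exists 1 => z; rewrite mul1r.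
exists (W `&` [set z | h q + eps / 2 < h z]); split.
- exact: polyhedronI.
- by move=> z [].
- exists x; case: xWD => Wx Dx; do 2 split => //=.
  by rewrite -ltrBrDl -linear_formB// hx.
- move=> z cz; have hz : h q + eps / 2 <= h z.
    by apply: (weak_closure_ge dh _ cz) => y [_ /ltW].
  apply: le_trans (le_trans (ler_norm _) (hn _)).
  by rewrite linear_formB// lerBrDl.
Qed.

Lemma rough_avoid_seq W (s : seq X) : polyhedron W -> W `&` D !=set0 ->
  exists V, [/\ polyhedron V, V `<=` W, V `&` D !=set0 &
    forall z q, closure (V : set weak) z -> q \in s -> eps / 2 <= `|z - q|].
Proof.
elim: s W => [|q s ih] W pW WD; first by exists W; split.
have [V [pV VW VD Vq]] := rough_avoid_point q pW WD.
have [U [pU UV UD Us]] := ih V pV VD.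
exists U; split=> //; first exact: subset_trans VW.
move=> z r cz; rewrite inE => /predU1P[->|]; last exact: Us.
by apply: Vq; exact: closureS cz.
Qed.

(** Finitely many balls of radius [eps / 4] cover [B]; avoiding their centres by [eps / 2]
    suffices. *)
Lemma rough_avoid_compact W B : compact B -> polyhedron W -> W `&` D !=set0 ->
  exists V, [/\ polyhedron V, V `<=` W, V `&` D !=set0 &
    forall z b, closure (V : set weak) z -> B b -> eps / 4 <= `|z - b|].
Proof.
rewrite compact_cover => cB pW WD.
have [] := cB X setT (fun q => ball q (eps / 4)).
- by move=> q _; exact: ball_open.
- by move=> b _; exists b => //; apply: ballxx; rewrite divr_gt0.
move=> s _ Bs; have [V [pV VW VD Vs]] := rough_avoid_seq (enum_fset s) pW WD.
exists V; split=> // z b cz /Bs[q /= qs]; rewrite -ball_normE /= => qb.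
have := Vs z q cz qs; have := ler_distD b z q; rewrite (distrC b) => ? ?; lra.
Qed.

End rough.

(* Otherwise one can pick points [x_n] of [D] in a decreasing sequence of
   polyhedra such that the [n+1]-st stays at distance [eps / 4] from the [n]-th
   box on the points chosen so far. A weak cluster point of [x_n] is then at
   positive distance from their linear span, contradicting Hahn-Banach. *)
Lemma weakly_compact_fragmented D (eps : R) : 0 < eps -> D !=set0 ->
  weakly_compact D -> exists W, [/\ polyhedron W, W `&` D !=set0 &
    forall x y, (W `&` D) x -> (W `&` D) y -> `|x - y| <= eps].
Proof.
move=> eps0 D0 cD; apply: contrapT => nofrag.
have rough W : polyhedron W -> W `&` D !=set0 ->
    exists x y, [/\ (W `&` D) x, (W `&` D) y & eps < `|x - y|].
  move=> pW WD; apply: contrapT => h; apply: nofrag; exists W; split => //.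
  move=> x y Wx Wy; rewrite leNgt; apply/negP => xy; apply: h.
  by exists x, y.
pose inv (st : set X * seq X) := polyhedron st.1 /\ st.1 `&` D !=set0.
(* The invariant is a premise because dependent choice asks for a successor of every state. *)
pose step (st st' : set X * seq X) := inv st -> [/\ inv st', st'.1 `<=` st.1,
  exists x, (st'.1 `&` D) x /\ st'.2 = x :: st.2 &
  forall z b, closure (st'.1 : set weak) z -> box (size st.2)%:R st.2 b ->
    eps / 4 <= `|z - b|].
have stepP st : {st' | step st st'}.
  apply: cid; have [[pW WD]|ninv] := pselect (inv st); last by exists st => /ninv.
  have [V [pV VW [x VDx] Vfar]] :=
    rough_avoid_compact eps0 rough (@box_compact _ _ (size st.2)%:R st.2) pW WD.
  by exists (V, x :: st.2) => _; split => //=; [split => //; exists x|exists x].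
have [u [u0 /= ustep]] := dependent_choice stepP (setT, [::]).
have uinv n : inv (u n).
  elim: n => [|n ih]; last by have [] := ustep n ih.
  by rewrite u0; split=> /=; [exact: polyhedronT|rewrite setTI].
have udec m n : (u (m + n)%N).1 `<=` (u n).1.
  elim: m => [|m ih] //; rewrite addSn; apply: subset_trans ih.
  by have [] := ustep _ (uinv (m + n)%N).
have usuf m n : exists t, (u (m + n)%N).2 = t ++ (u n).2.
  elim: m => [|m [t ih]]; first by exists [::].
  have [_ _ [x [_]]] := ustep _ (uinv (m + n)%N).
  by rewrite addSn => -> _; exists (x :: t); rewrite ih.
have usize n : size (u n).2 = n.
  elim: n => [|n ih]; first by rewrite u0.
  by have [_ _ [x [_ ->]] _] := ustep _ (uinv n); rewrite /= ih.
have /choice[w wP] n : exists x, ((u n.+1).1 `&` D) x /\ (u n.+1).2 = x :: (u n).2.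
  by have [] := ustep _ (uinv n).
have [|z [Dz clz]] := cD ((w : nat -> weak) @ \oo) _.
  by exists 0%N => // n _; exact: (wP n).1.2.
have clu n : closure ((u n).1 : set weak) z.
  move=> B Bz; apply: clz => //; exists n => // m /= nm.
  apply: (udec (m.+1 - n)%N n); rewrite subnK; last exact: leqW.
  exact: (wP m).1.1.
pose M b := exists n N, [/\ 0 <= N & box N (u n).2 b].
have M0 : M 0 by exists 0%N, 0; split => //; exact: box0.
have MD x y : M x -> M y -> M (x + y).
  move=> [m [K [K0 bx]]] [n [L [L0 bly]]]; exists (m + n)%N, (K + L).
  have [s sE] := usuf n m; have [t tE] := usuf m n.
  split; first exact: addr_ge0.
  apply: boxD; last by rewrite tE; exact: box_cat.
  by rewrite addnC sE; exact: box_cat.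
have MZ (a : R) x : M x -> M (a *: x).
  move=> [m [K [K0 bx]]]; exists m, (`|a| * K).
  by split; [rewrite mulr_ge0|exact: boxZ].
have far m : M m -> eps / 4 <= `|z - m|.
  move=> [n [K [K0 bm]]].
  (* After [k.+1] further steps the box has size above [K], so it contains [m]. *)
  pose k := Num.truncn K; have [t tE] := usuf k.+1 n.
  have [_ _ _] := ustep _ (uinv (k.+1 + n)%N); apply; first exact: clu.
  rewrite usize; apply: (@box_widen _ _ K).
    by rewrite (le_trans (ltW (truncnS_gt K)))// ler_nat leq_addr.
  by rewrite tE; exact: box_cat.
have [g [dg gM gz]] := dist_subspace_form M0 MD MZ (divr_gt0 eps0 (ltr0n _ 4)) far.
have gw n : g (w n) = 0.
  apply: gM; exists n.+1, 1; split=> //.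
  by rewrite (wP n).2; exact: box_head.
(* The set where [g > 0] is a weak neighbourhood of [z] that misses the whole sequence. *)
have [||x [/= gx0 /=]] := clz [set x | g x = 0] (g @^-1` [set r | 0 < r]).
- by exists 0%N => // n _; exact: gw.
- apply: open_nbhs_nbhs; split; first exact: dual_form_weak_open dg (@open_gt R 0).
  by apply: lt_le_trans gz; rewrite divr_gt0.
by rewrite gx0 ltxx.
Qed.

End fragmentation.

(** * Slices and strongly exposed points *)

Section slices.
Context {R : realType} {X : normedModType R}.
Local Notation weak := (weak_type X).
Implicit Types (x y z u : X) (W J : set X) (f g h : X -> R).

Lemma polyhedron_absorbs W J x : polyhedron W -> W x -> J !=set0 ->
  weakly_compact J -> exists2 l : R, 0 < l & forall m y, 0 <= m <= l -> J y ->
    W (x + m *: (y - x)).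
Proof.
move=> + + J0 cJ; elim=> [_|{}W g a _ ih dg [Wx /= ax]]; first by exists 1.
have [l l0 lW] := ih Wx.
have [z Jz zmin] : exists2 z, J z & forall y, J y -> g z <= g y.
  have dN : dual_form (fun x => 0 + -1 * g x).
    have d0 : dual_form (fun _ : X => 0 : R).
      split=> [b y z|]; first by rewrite mulr0 addr0.
      by exists 0 => y; rewrite normr0 mul0r.
    exact: dual_formD.
  have [z Jz zmax] := weakly_compact_max dN J0 cJ; exists z => // y /zmax.
  by move=> ?; lra.
have d0 : 0 < 1 + `|g z - g x| by rewrite ltr_pwDl.
(* The summand 1 makes the denominator positive and the bound strict for [m > 0]. *)
exists (Num.min l ((g x - a) / (1 + `|g z - g x|))).
  by rewrite lt_min l0 divr_gt0// subr_gt0.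
move=> m y /andP[m0]; rewrite le_min => /andP[ml mg] Jy; split.
  by apply: lW => //; rewrite m0.
rewrite /= (linear_formD _ _ dg.1) (linear_formZ _ _ dg.1) (linear_formB _ _ dg.1).
move: mg; rewrite ler_pdivlMr// => mg.
have h1 : m * (g z - g x) <= m * (g y - g x) by rewrite ler_wpM2l// lerD2r zmin.
have h2 : - (m * `|g z - g x|) <= m * (g z - g x).
  by rewrite -mulrN ler_wpM2l// lerNl; have := ler_norm (- (g z - g x)); rewrite normrN.
have [->|m0'] := eqVneq m 0; first by rewrite mul0r addr0.
have {m0'}m0' : 0 < m by rewrite lt_neqAle eq_sym m0'.
lra.
Qed.

(** Contracting [J] towards [x] by a factor [m] puts it into a piece of diameter at most 1, so
    [m * |y - x| <= 1] on [J]. *)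
Lemma cwk_bounded J : cwk J ->
  exists2 C : R, 0 < C & forall x, J x -> `|x| <= C.
Proof.
move=> [J0 convJ cJ].
have [W [pW [x [Wx Jx]] Wsmall]] := weakly_compact_fragmented ltr01 J0 cJ.
have [l l0 lW] := polyhedron_absorbs pW Wx J0 cJ.
pose m := Num.min l 1.
have m01 : 0 < m <= 1 by rewrite lt_min l0 ltr01/= ge_min lexx orbT.
have [m0 m1] := andP m01.
exists (m^-1 + `|x|); first by rewrite ltr_pwDl// invr_gt0.
move=> y Jy.
have Jxy : J (x + m *: (y - x)).
  have m0' : 0 <= m by exact: ltW.
  have := convJ _ _ (Itv01 m0' m1) (mem_set Jy) (mem_set Jx) => /set_mem.
  congr J; rewrite -[LHS]/(m *: y + (1 - m) *: x).
  by rewrite scalerBr scalerBl scale1r addrCA.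
have Wxy : W (x + m *: (y - x)) by apply: lW => //; rewrite ltW//= ge_min lexx.
have := Wsmall _ _ (conj Wxy Jxy) (conj Wx Jx).
rewrite addrAC subrr add0r normrZ gtr0_norm// -ler_pdivlMl// mulr1 => h.
by have := ler_normD (y - x) x; rewrite subrK => ?; lra.
Qed.

(** For [x] in [J], membership in the slice of depth [d], written without a supremum. *)
Definition almost_max J g (d : R) x := forall y, J y -> g y <= g x + d.

(* Zorn's lemma yields a minimal weakly closed [D] in [J] on which every form
   near [f] attains its maximum over [J]; removing from [D] a relatively weakly
   open piece of small diameter destroys this property for some form [g], and
   [g] has small slices. *)
Lemma small_slice J f (r e : R) : cwk J -> dual_form f -> 0 < r -> 0 < e ->
  exists g, [/\ dual_form g, forall x, `|g x - f x| <= r * `|x| &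
    exists2 d, 0 < d &
      exists u, forall x, J x -> almost_max J g d x -> `|x - u| <= 2 * e].
Proof.
move=> cwkJ df r0 e0; have [J0 _ cJ] := cwkJ.
(* The open ball of radius [r] around [f]; the gap [r - s] leaves room to perturb [g]. *)
pose G g := dual_form g /\
  exists2 s : R, 0 <= s < r & forall x, `|g x - f x| <= s * `|x|.
have Gf : G f.
  split=> //; exists 0; first by rewrite lexx.
  by move=> x; rewrite subrr normr0 mul0r.
(* [E] is the removed part: a maximal [E] gives a minimal [J]\[E]. *)
pose good E := open (E : set weak) /\
  forall g, G g -> exists2 x, (J `\` E) x & forall y, J y -> g y <= g x.
have [E [[oE gE] Emax]] : exists A, good A /\ forall B, A `<` B -> ~ good B.
  apply: Zorn_bigcup => F Fgood totF; split.
    by apply: bigcup_open => A /Fgood[].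
  move=> g Gg; have [F0|F0] := pselect (F !=set0); last first.
    have [x Jx xmax] := weakly_compact_max Gg.1 J0 cJ; exists x => //.
    by split=> // -[A FA _]; apply: F0; exists A.
  have [x0 Jx0 x0max] := weakly_compact_max Gg.1 J0 cJ.
  (* Maximisers of [g] outside the members of the chain; they cluster weakly at a maximiser outside
     the union. *)
  pose K A := J `&` [set x | g x0 <= g x] `\` A.
  pose Phi := filter_from F K.
  have PhiF : ProperFilter (Phi : set_system weak).
    apply: filter_from_proper.
      apply: filter_from_filter => // A B FA FB.
      have [AB|BA] := totF _ _ FA FB; [exists B|exists A] => // x [Kx nx].
        by do 2 split => //; move/AB.
      by do 2 split => //; move/BA.
    move=> A FA; have [x [Jx nAx] xmax] := (Fgood _ FA).2 _ Gg.
    by exists x; split => //; split => //=; exact: xmax.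
  have PhiJ : Phi J by have [A FA] := F0; exists A => // x [[]].
  have [z [Jz clz]] := cJ Phi PhiF PhiJ.
  have zmax : g x0 <= g z.
    apply: (@weak_closure_ge _ _ [set x | g x0 <= g x]) => //; first exact: Gg.1.
    move: clz; rewrite clusterE; apply; have [A FA] := F0.
    by exists A => // x [[]].
  exists z; last by move=> y Jy; exact: le_trans (x0max _ Jy) zmax.
  split=> // -[A FA Az]; have [||x [[_ nAx] /nAx]//] := clz (K A) A.
    by exists A.
  by apply: open_nbhs_nbhs; split => //; exact: (Fgood _ FA).1.
have cJE A : open (A : set weak) -> compact ((J `\` A) : set weak).
  move=> oA; rewrite setDE; apply: compact_closedI => //.
  exact: open_closedC.
have JE0 : J `\` E !=set0 by have [x xE _] := gE f Gf; exists x.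
have [W [pW [u0 [Wu0 JEu0]] Wsmall]] := weakly_compact_fragmented e0 JE0 (cJE _ oE).
have oW := polyhedron_weak_open pW.
have ngood : ~ good (E `|` W).
  apply: Emax; split; first by move=> x; left.
  by move=> /(_ u0 (or_intror Wu0)); exact: JEu0.2.
have [g Gg gbad] : exists2 g, G g & forall x, (J `\` (E `|` W)) x ->
    exists2 y, J y & g x < g y.
  apply: contrapT => h; apply: ngood; split; first exact: openU.
  move=> g Gg; apply: contrapT => h'; apply: h; exists g => // x xJ.
  apply: contrapT => h''; apply: h'; exists x => // y Jy.
  by rewrite leNgt; apply/negP => gxy; apply: h''; exists y.
have [xM JxM gxM] := weakly_compact_max Gg.1 J0 cJ.
have [m mM mle] : exists2 m, m < g xM & forall x, J x -> ~ E x -> ~ W x -> g x <= m.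
  have [JEW|JEW] := pselect ((J `\` (E `|` W)) !=set0); last first.
    exists (g xM - 1); first by rewrite ltrBlDr ltrDl.
    by move=> x Jx nE nW; exfalso; apply: JEW; exists x; split => // -[].
  have [x xJ xmax] := weakly_compact_max Gg.1 JEW (cJE _ (openU oE oW)).
  have [y Jy gxy] := gbad _ xJ; exists (g x).
    exact: lt_le_trans gxy (gxM _ Jy).
  by move=> z Jz nE nW; apply: xmax; split => // -[].
have [C C0 JC] := cwk_bounded cwkJ.
have [dg [s /andP[s0 sr] gs]] := Gg.
(* [c] keeps [g + c h] in [G] and [2 * c * C] within a quarter of the gap [g xM - m]. [d] is below
   both the gain [c * e] from [h] and another quarter of the gap. *)
pose c := Num.min ((r - s) / 2) ((g xM - m) / (8 * C)).
have c0 : 0 < c.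
  by rewrite lt_min !divr_gt0// ?mulr_gt0// subr_gt0.
pose d := Num.min (c * e / 2) ((g xM - m) / 4).
have d0 : 0 < d by rewrite lt_min !divr_gt0// ?mulr_gt0// subr_gt0.
exists g; split=> //.
  by move=> x; apply: (le_trans (gs x)); rewrite ler_wpM2r// ltW.
exists d => //; exists u0 => x Jx xd; rewrite leNgt; apply/negP => xu0.
have [h lh [hn hx]] := norming_form (x - u0).
have dh : dual_form h by split=> //; exists 1 => z; rewrite mul1r.
have Ggh : G (fun x => g x + c * h x).
  split; first exact: dual_formD.
  exists (s + c).
    rewrite addr_ge0 ?(ltW c0)//=.
    have : c <= (r - s) / 2 by rewrite ge_min lexx.
    lra.
  move=> z; rewrite addrAC mulrDl; apply: (le_trans (ler_normD _ _)).
  by rewrite lerD// normrM gtr0_norm// ler_pM2l.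
(* [x] does not beat the maximiser [z] of the perturbed form [g + c h], which
   is impossible whether [z] lies in [W] or not. *)
have [z [Jz nEz] zmax] := gE _ Ggh.
have {zmax}zx := zmax _ Jx; have xle := xd _ JxM.
move: (linear_formB x u0 lh); rewrite hx => hxu.
have [Wz|nWz] := pselect (W z).
  have hz : h z - h u0 <= e.
    rewrite -linear_formB//; apply: le_trans (ler_norm _) _.
    by apply: le_trans (hn _) _; apply: Wsmall.
  have gz := gxM _ Jz.
  have hd : d <= c * e / 2 by rewrite ge_min lexx.
  nra.
have gz := mle _ Jz nEz nWz.
have hzx : h z - h x <= 2 * C.
  rewrite -linear_formB//; apply: le_trans (ler_norm _) _.
  apply: le_trans (hn _) _; apply: le_trans (ler_normB _ _) _.
  by have := JC _ Jz; have := JC _ Jx; lra.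
have hd : d <= (g xM - m) / 4 by rewrite ge_min lexx orbT.
have hc : c * C <= (g xM - m) / 8.
  have : c <= (g xM - m) / (8 * C) by rewrite ge_min lexx orbT.
  by rewrite invfM mulrA ler_pdivlMr.
nra.
Qed.

(** On the bounded set [J], a form near [g] differs from it by at most [d / 4], so its [d / 2]-slice
    lies in the [d]-slice of [g]. The radius [2 * s] matches the bound in [dual_form_limit]. *)
Lemma small_slice_stable J f (r e : R) : cwk J -> dual_form f ->
  0 < r -> 0 < e -> exists g (s : R), [/\ dual_form g, forall x, `|g x - f x| <= r * `|x|,
    0 < s <= r / 2 & exists2 d : R, 0 < d & exists u, forall h,
      (forall x, `|h x - g x| <= 2 * s * `|x|) ->
      forall x, J x -> almost_max J h d x -> `|x - u| <= e].
Proof.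
move=> cJ df r0 e0; have [C C0 JC] := cwk_bounded cJ.
have e20 : 0 < e / 2 by rewrite divr_gt0.
have [g [dg gf [d d0 [u gu]]]] := small_slice cJ df r0 e20.
pose s := Num.min (r / 2) (d / (8 * C)).
have s0 : 0 < s by rewrite lt_min !divr_gt0// mulr_gt0.
have sC : s * C <= d / 8.
  have : s <= d / (8 * C) by rewrite ge_min lexx orbT.
  by rewrite invfM mulrA ler_pdivlMr.
exists g, s; split=> //; first by rewrite s0 ge_min lexx.
exists (d / 2); first by rewrite divr_gt0.
exists u => h hg x Jx hx; have -> : e = 2 * (e / 2) by rewrite mulrC divfK.
apply: gu => // y Jy.
have close z : J z -> `|h z - g z| <= d / 4.
  move=> Jz; apply: le_trans (hg z) _.
  have : s * `|z| <= s * C by rewrite ler_pM2l// JC.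
  by lra.
have := close _ Jx; have := close _ Jy; rewrite !ler_norml => /andP[? ?] /andP[? ?].
by have := hx _ Jy; lra.
Qed.

Lemma archimedean_le0 (D K : R) : (forall n, n.+1%:R * D <= K) -> D <= 0.
Proof.
move=> DK; rewrite leNgt; apply/negP => D0.
have := DK (Num.truncn (K / D)); rewrite leNgt -ltr_pdivrMr//.
by rewrite truncnS_gt.
Qed.

(** Completeness of the dual: as the radii at least halve, the steps after [n] sum to at most
    [2 * rs n], and the limit is the supremum of the resulting lower bounds. *)
Lemma dual_form_limit (gs : nat -> X -> R) (rs : nat -> R) :
  (forall n, dual_form (gs n)) -> (forall n, 0 < rs n) ->
  (forall n, rs n.+1 <= rs n / 2) ->
  (forall n x, `|gs n.+1 x - gs n x| <= rs n * `|x|) ->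
  exists2 g, dual_form g & forall n x, `|g x - gs n x| <= 2 * rs n * `|x|.
Proof.
move=> dgs rs0 rs2 gsS.
have tail m n x : `|gs (m + n)%N x - gs n x| <= 2 * (rs n - rs (m + n)%N) * `|x|.
  elim: m => [|m ih]; first by rewrite !subrr normr0 mulr0 mul0r.
  have := ler_distD (gs (m + n)%N x) (gs (m.+1 + n)%N x) (gs n x).
  have := gsS (m + n)%N x; rewrite -addSn => h1 h2.
  have : rs (m.+1 + n)%N * `|x| <= rs (m + n)%N / 2 * `|x|.
    by rewrite ler_wpM2r// rs2.
  lra.
have close m n x : gs m x - 2 * rs m * `|x| <= gs n x + 2 * rs n * `|x|.
  have pos k : 0 <= rs k * `|x| by rewrite mulr_ge0// ltW.
  have := pos m; have := pos n.
  have [mn|nm] := leqP m n.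
    have := tail (n - m)%N m x; rewrite subnK// ler_norml => /andP[? ?] ? ?; lra.
  have := tail (m - n)%N n x; rewrite subnK ?(ltnW nm)// ler_norml => /andP[? ?] ? ?.
  lra.
pose g x := sup [set gs n x - 2 * rs n * `|x| | n in setT].
have gP n x : `|g x - gs n x| <= 2 * rs n * `|x|.
  rewrite ler_distl; apply/andP; split.
    apply: ub_le_sup; last by exists n.
    by exists (gs 0%N x + 2 * rs 0%N * `|x|) => _ [m _ <-].
  apply: ge_sup; first by exists (gs 0%N x - 2 * rs 0%N * `|x|), 0%N.
  by move=> _ [m _ <-].
exists g => //; split; last first.
  have [_ [C gC]] := dgs 0%N; exists (C + 2 * rs 0%N) => x.
  rewrite -(subrK (gs 0%N x) (g x)) mulrDl addrC.
  by apply: (le_trans (ler_normD _ _)); rewrite lerD.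
(* This decay lets [archimedean_le0] kill the linearity defect, at most [2 * rs n * K]. *)
have rsn n : n.+1%:R * rs n <= rs 0%N.
  elim: n => [|n ih]; first by rewrite mul1r.
  apply: le_trans ih; apply: (@le_trans _ _ (n.+2%:R * (rs n / 2))).
    by rewrite ler_pM2l ?ltr0n.
  rewrite mulrA mulrAC ler_pM2r// ler_pdivrMr// -natrM ler_nat muln2.
  by rewrite doubleS !ltnS -addnn leq_addr.
move=> a x y; apply/eqP; rewrite -subr_eq0 -normr_le0.
pose K := `|a *: x + y| + `|a| * `|x| + `|y|.
apply: (@archimedean_le0 _ (2 * rs 0%N * K)) => n.
have -> : g (a *: x + y) - (a * g x + g y) = (g (a *: x + y) - gs n (a *: x + y))
    - (a * (g x - gs n x) + (g y - gs n y)) by rewrite (dgs n).1; ring.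
apply: (@le_trans _ _ (n.+1%:R * (2 * rs n * K))); last first.
  have -> : n.+1%:R * (2 * rs n * K) = 2 * (n.+1%:R * rs n) * K by ring.
  by rewrite ler_wpM2r ?addr_ge0// ?mulr_ge0// ler_pM2l.
rewrite ler_pM2l ?ltr0n//; apply: le_trans (ler_normB _ _) _.
rewrite /K -addrA [leRHS]mulrDr lerD//; apply: le_trans (ler_normD _ _) _.
rewrite [leRHS]mulrDr lerD// normrM [leRHS]mulrCA.
by rewrite ler_wpM2l// gP.
Qed.

(* Baire's argument in the dual, for the dense open sets of the forms that have
   a slice in a ball of radius [1/n]. *)
Lemma cwk_strongly_exposed J : cwk J -> exists g x, [/\ dual_form g, J x,
  forall y, J y -> g y <= g x & forall e : R, 0 < e -> exists2 d : R, 0 < d &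
    forall z, J z -> almost_max J g d z -> `|z - x| <= e].
Proof.
move=> cJ; pose inv (st : (X -> R) * R * nat) := dual_form st.1.1 /\ 0 < st.1.2.
pose step (st st' : (X -> R) * R * nat) := inv st ->
  [/\ inv st', forall x, `|st'.1.1 x - st.1.1 x| <= st.1.2 * `|x|,
   st'.1.2 <= st.1.2 / 2, st'.2 = st.2.+1 &
   exists2 d : R, 0 < d & exists u, forall h,
     (forall x, `|h x - st'.1.1 x| <= 2 * st'.1.2 * `|x|) ->
     forall x, J x -> almost_max J h d x -> `|x - u| <= st.2.+1%:R^-1].
have stepP st : {st' | step st st'}.
  apply: cid; have [[df r0]|ninv] := pselect (inv st); last by exists st => /ninv.
  have e0 : (0 : R) < st.2.+1%:R^-1 by rewrite invr_gt0.
  have [g [s [dg gf /andP[s0 sr] gd]]] := small_slice_stable cJ df r0 e0.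
  by exists (g, s, st.2.+1) => _; split.
have [u [u0 ustep]] := dependent_choice stepP (fun=> 0, 1, 0%N).
have uinv n : inv (u n).
  elim: n => [|n ih]; last by have [] := ustep n ih.
  rewrite u0; split=> //; split=> [a x y|]; first by rewrite mulr0 addr0.
  by exists 0 => x; rewrite normr0 mul0r.
have un n : (u n).2 = n.
  elim: n => [|n ih]; first by rewrite u0.
  by have [_ _ _ -> _] := ustep n (uinv n); rewrite ih.
have [||||g dg gP] := @dual_form_limit (fun n => (u n).1.1) (fun n => (u n).1.2).
- by move=> n; exact: (uinv n).1.
- by move=> n; exact: (uinv n).2.
- by move=> n; have [] := ustep n (uinv n).
- by move=> n; have [] := ustep n (uinv n).
have [J0 _ wJ] := cJ; have [x Jx xmax] := weakly_compact_max dg J0 wJ.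
exists g, x; split=> // e e0; pose n := Num.truncn (2 / e).
have [_ _ _ _ [d d0 [v gv]]] := ustep n (uinv n).
exists d => // z Jz zmax; rewrite un in gv.
(* The maximiser [x] lies in every slice, so the unknown centre [v] can be traded for [x]. *)
have vx : `|x - v| <= n.+1%:R^-1.
  apply: (gv g) => //.
  by move=> y Jy; apply: (le_trans (xmax _ Jy)); rewrite lerDl ltW.
have vz : `|z - v| <= n.+1%:R^-1 by apply: (gv g).
have ne : n.+1%:R^-1 <= e / 2.
  rewrite -[leRHS]invrK lef_pV2 ?posrE ?invr_gt0 ?divr_gt0//.
  by rewrite invf_div ltW// truncnS_gt.
have := ler_distD v z x; rewrite (distrC v x).
have := le_trans vx ne; have := le_trans vz ne; lra.
Qed.

End slices.

(** * Hausdorff approximation and the integrable selection *)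

Lemma hausdorff_dist_lt (R : realType) (X : normedModType R) (A B : set X)
    (e e' : R) : (hausdorff_dist A B <= e%:E)%E -> e < e' ->
  (forall a, A a -> exists2 b, B b & `|a - b| < e') /\
  (forall b, B b -> exists2 a, A a & `|b - a| < e').
Proof.
have excess_lt (C D : set X) : (excess C D <= e%:E)%E -> e < e' ->
    forall c, C c -> exists2 d, D d & `|c - d| < e'.
  move=> CDe ee' c Cc.
  have /ereal_inf_lt[_ [d Dd <-]] :
      (ereal_inf [set `|c - b|%:E | b in D] < e'%:E)%E.
    apply: le_lt_trans (_ : (e%:E < e'%:E)%E); last by rewrite lte_fin.
    by apply: le_trans CDe; apply: ereal_sup_ubound; exists c.
  by rewrite lte_fin => cd; exists d.
rewrite /hausdorff_dist ge_max => /andP[AB BA] ee'.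
by split; exact: excess_lt.
Qed.

Theorem theorem3p2 (R : realType) (T : pointedMetricType R)
    (X : completeNormedModType R)
    (mu : {finite_measure set (borel_type T) -> \bar R})
    (F : T -> set X)
    (T_compact : compact [set: T])
    (mu_regular : regular_measure mu)
    (mu_nonatomic : pointwise_nonatomic mu)
    (F_cwk : forall t, cwk (F t))
    (F_int : H_integrable_multi mu F) :
  exists f : T -> X, H_integrable mu f /\ {ae mu, forall t, F t (f t)}.
Proof.
have [J cwkJ FJ] := F_int.
have [g [x0 [dg Jx0 x0max x0exposed]]] := cwk_strongly_exposed cwkJ.
have [lg [C0 gC0]] := dg.
pose C := `|C0| + 1.
have C1 : 1 <= C by rewrite lerDr.
have gC x : `|g x| <= C * `|x|.
  apply: le_trans (gC0 x) _; rewrite ler_wpM2r//.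
  by rewrite (le_trans (ler_norm _))// lerDl.
have /choice[f fP] t : exists y, F t y /\ forall x, F t x -> g x <= g y.
  have [F0 _ wF] := F_cwk t.
  by have [y Fy ymax] := weakly_compact_max dg F0 wF; exists y.
exists f; split; last by apply: aeW => t; exact: (fP t).1.
have gsum k (x : 'I_k -> X) (c : 'I_k -> R) :
    g (\sum_(i < k) c i *: x i) = \sum_(i < k) c i * g (x i).
  elim/big_rec2: _ => [|i y1 y2 _ <-]; first exact: linear_form0.
  by rewrite lg.
exists x0 => e e0; have e20 : 0 < e / 2 by rewrite divr_gt0.
have [d d0 dP] := x0exposed _ e20.
(* [e / 2] serves the final triangle inequality; [d / (2 * C)] makes [g] vary by at most [d / 2]
   over a distance [r]. The gauge is taken for [r / 2] since [hausdorff_dist_lt] needs a strictly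
   larger bound. *)
pose r := Num.min (e / 2) (d / (2 * C)).
have r0 : 0 < r by rewrite lt_min e20 divr_gt0// mulr_gt0// (lt_le_trans _ C1).
have r20 : 0 < r / 2 by rewrite divr_gt0.
have [gam gamP] := FJ _ r20; exists gam => k E t partE fine_t.
set S := \sum_(i < k) _.
have r2r : r / 2 < r by lra.
have [sumJ Jsum] := hausdorff_dist_lt (gamP k E t partE fine_t) r2r.
have [y Jy Sy] : exists2 y, J y & `|S - y| < r.
  apply: sumJ; exists (fun i => fine (mu (E i)) *: f (t i)) => // i.
  by exists (f (t i)) => //; exact: (fP _).1.
have [s [x xF sE] x0s] := Jsum _ Jx0.
(* The weights are nonnegative, so maximising [g] termwise maximises it over the Minkowski sum. *)
have gsS : g s <= g S.
  have /choice[z zP] i : exists z, F (t i) z /\ fine (mu (E i)) *: z = x i.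
    by have [z Fz zx] := xF i; exists z.
  rewrite -sE (eq_bigr (fun i => fine (mu (E i)) *: z i)); last first.
    by move=> i _; rewrite (zP i).2.
  rewrite /S !gsum; apply: ler_sum => i _; rewrite ler_wpM2l//.
    exact: fine_ge0.
  exact: (fP _).2 _ (zP i).1.
have Cr : C * r <= d / 2.
  have : r <= d / (2 * C) by rewrite ge_min lexx orbT.
  by rewrite invfM mulrA ler_pdivlMr ?(lt_le_trans _ C1)// mulrC.
have lip a b : `|a - b| < r -> g a - g b <= d / 2.
  move=> ab; rewrite -linear_formB//; apply: le_trans (ler_norm _) _.
  apply: le_trans (gC _) (le_trans _ Cr).
  by rewrite ler_wpM2l ?(le_trans _ C1)// ltW.
(* For [z] in [J]: [g z <= g x0 <= g s + d / 2 <= g S + d / 2 <= g y + d]. *)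
have yx0 : `|y - x0| <= e / 2.
  apply: dP => // z Jz; have := x0max _ Jz; have := lip _ _ x0s.
  by have := lip _ _ Sy; lra.
have rE : r <= e / 2 by rewrite ge_min lexx.
by have := ler_distD y S x0; lra.
Qed.
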